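(* Let $\epsilon=1.4$ and $\xi=0.1$. Then, for each $\tau\in[0.75,0.8]$, the transfer operator $L_\tau$ of the Arnold map with additive noise and parameters $(\epsilon,\tau,\xi)$ is mixing in the following sense: for each $g\in BV(S^1)$ with $\int_{S^1} g\,dm=0$, $$\lim_{n\to\infty}\|L_\tau^n g\|_{L^1}=0.$$
   Context: $S^1=\mathbb{R}/\mathbb{Z}$ with Lebesgue (Haar) probability measure $m$. $BV(S^1)$ is the set of $f\in L^1(S^1,m)$ with finite variation, where $Var(f)$ is the supremum over finite cyclic partitions $x_0=x_n,x_1,\dots,x_n$ of $\sum_{k=1}^n|f(x_k)-f(x_{k-1})|$ (functions understood up to a.e. equality in the usual way). The Arnold map is $T_{\tau,\epsilon}(x)=x+\tau-\frac{\epsilon}{2\pi}\sin(2\pi x)\bmod 1$ on $S^1$. The Arnold map with noise is the process $X_{n+1}=T_{\tau,\epsilon}(X_n)+\Omega_n\bmod 1$ with $(\Omega_n)$ i.i.d. uniformly distributed on $[-\xi/2,\xi/2]$. Its transfer operator is $L_\tau:L^1\to L^1$, $L_\tau f=\rho_\xi\ast L_{T_{\tau,\epsilon}}f$, where $L_{T}$ is the pushforward operator on (densities of) measures, $(L_T\mu)(A)=\mu(T^{-1}(A))$, $\rho_\xi=\frac1\xi\mathbf{1}_{[-\xi/2,\xi/2]}$ is the noise density viewed on $S^1$, and $\ast$ is convolution on $S^1$. *)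

(* Defs.v *)
(* The circle R/Z is handled through its universal cover: a function on the
   circle is a function of period 1 on the real line, a subset of the circle is
   a set invariant under the translation by 1, and a self-map of the circle of
   degree 1 is given by a lift T, with T (x + 1) = T x + 1.  Reduction modulo 1
   is then implicit: composing a function of period 1 with T, or taking the
   preimage under T of a set of period 1, only depends on T modulo 1. *)
From HB Require Import structures.
From mathcomp Require Import all_boot all_order all_algebra.
From mathcomp Require Import all_classical all_reals all_analysis.

Set Implicit Arguments.
Unset Strict Implicit.
Unset Printing Implicit Defensive.

Import Order.TTheory GRing.Theory Num.Theory.
Import numFieldNormedType.Exports.
Local Open Scope classical_set_scope.
Local Open Scope ring_scope.

(* The uniform law on the fundamental domain [0, 1] gives the Haar measure to
   each periodic set; the two endpoints, identified in R/Z, have measure 0. *)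
Definition haar (R : realType) : probability (measurableTypeR R) R :=
  uniform_prob (@ltr01 R).

Definition periodic_set (R : realType) (A : set R) :=
  forall x, A (x + 1) <-> A x.

(* Elements of L^1 are represented by Borel functions; no quotient is taken. *)
Definition circle_L1 (R : realType) (f : R -> R) : Prop :=
  periodic f 1 /\ (haar R).-integrable setT (EFin \o f).

(* A cyclic partition of the circle starting from the class of a lifts to a
   partition of the interval [a, a + 1]. *)
Definition circle_variation (R : realType) (f : R -> R) : \bar R :=
  ereal_sup (range (fun a : R => total_variation a (a + 1) f)).

Definition circle_BV (R : realType) (f : R -> R) : Prop :=
  circle_L1 f /\
  exists f' : R -> R, [/\ periodic f' 1, f = f' %[ae (haar R)] &
    (circle_variation f' < +oo)%E].

Definition arnold_map (R : realType) (tau epsilon x : R) : R :=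
  x + tau - epsilon / (2 * pi) * sin (2 * pi * x).

Definition pushforward_density (R : realType) (T f h : R -> R) : Prop :=
  circle_L1 h /\
  forall A : set R, measurable A -> periodic_set A ->
    (\int[haar R]_(y in A) (h y)%:E = \int[haar R]_(x in T @^-1` A) (f x)%:E)%E.

(* Densities of the pushforward are unique almost everywhere; [xget] picks one
   of them.  The default value 0 is only used when there is none, which does
   not happen for f in L^1 and T nonsingular (such as an Arnold map). *)
Definition pushforward_op (R : realType) (T f : R -> R) : R -> R :=
  xget (cst 0) [set h | pushforward_density T f h].

(* The indicator is that of the image of [- xi / 2, xi / 2] in R/Z; the density
   is normalized for xi <= 1. *)
Definition noise_density (R : realType) (xi : R) : R -> R :=
  fun x => xi^-1 *
    \1_[set y : R | exists k : int, y - k%:~R \in `[- (xi / 2), xi / 2]] x.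

Definition circle_convolution (R : realType) (f g : R -> R) : R -> R :=
  fun x => \int[haar R]_y (f (x - y) * g y).

Definition noisy_transfer (R : realType) (tau epsilon xi : R) (f : R -> R) :
    R -> R :=
  circle_convolution (noise_density xi)
    (pushforward_op (arnold_map tau epsilon) f).

(* Main.v *)
Require Import Defs.
From HB Require Import structures.
From mathcomp Require Import all_boot all_order all_algebra.
From mathcomp Require Import all_classical all_reals all_analysis.
From mathcomp Require Import measurable_realfun ring lra zify.

Set Implicit Arguments.
Unset Strict Implicit.
Unset Printing Implicit Defensive.

Import Order.TTheory GRing.Theory Num.Theory.
Import numFieldNormedType.Exports.
Local Open Scope classical_set_scope.
Local Open Scope ring_scope.

(** The noisy Arnold map is a Markov chain on the circle whose transition density
from x is uniform on the arc of length 1/10 centred at T x.  Such a chain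
contracts signed densities of mean zero as soon as Doeblin's condition holds:
for some N, the N-step transition density is bounded below, uniformly in the
starting point, by a positive multiple of the indicator of a fixed set J.

For the parameters of the theorem J can be taken to be [0.75, 0.76], because the
noise can be used to steer every point to J in exactly 100 steps.  Work with the
lift x |-> T x - 1.  Its displacement T x - 1 - x is at most 0.03
([arnold_le]; it is maximal at x = 0.75, where a saddle-node fixed point appears
for some tau in the range), so noise close to -0.05 always moves a
point backwards, by at least 0.02.  Conversely T x - 1 + 0.05 >= 0.76 for all
x >= 0.75 ([arnold_ge]), so a point on the right of 0.75 is never forced to jump
over J.  Hence if a nonnegative function is at least eta on an arc
[0.75, 0.75 + l] containing J, its mean after one step is at least eta/10 on the
arc [0.75, 0.75 + l + 0.01] ([koopman_arnold_step]); a hundred steps cover the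
whole circle.

Doeblin's argument is run on the dual side.  The Koopman operator averages a
bounded function against the transition density; the minorization makes it
contract oscillations ([osc_koopman_step]), and testing the n-th iterate of the
density against its own sign transfers the contraction to the L^1 norm
([norm_iter_transfer_le]).  Duality only involves functions defined at every
point, so no almost-everywhere classes occur in the estimates.

It remains to see that the operator of the theorem is the one given by the
transition density.  A density of the pushforward is only available through the
Radon-Nikodym theorem, hence the nonsingularity of T must be shown: preimages of
null sets are null ([negligible_preimage_arnold]).  Away from the critical points
T has a locally Lipschitz inverse, and the critical points themselves form a null
set because T'' does not vanish there.  Once the density exists, the convolution
with the noise at y is the integral of that density over a periodic set, and the
defining property of the pushforward turns it into an integral of f
([noise_convolution_pushforward]). *)

(** * Bounded measurable functions and integral kernels *)

Section bounded_measurable.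
Context d (T : measurableType d) (R : realType).

(** The test functions dual to L^1, bounded at every point and not only almost
everywhere: uniform bounds can then be propagated pointwise. *)
Definition bounded_measurable (f : T -> R) :=
  measurable_fun setT f /\ exists M : R, forall x, `|f x| <= M.

Lemma bounded_measurable_cst (c : R) : bounded_measurable (cst c).
Proof. by split=> //; exists `|c|. Qed.

Lemma bounded_measurableB (f g : T -> R) : bounded_measurable f ->
  bounded_measurable g -> bounded_measurable (fun x => f x - g x).
Proof.
move=> [mf [M fM]] [mg [N gN]]; split; first exact: measurable_funB.
by exists (M + N) => x; rewrite (le_trans (ler_normB _ _))// lerD.
Qed.

Lemma bounded_measurableM (f g : T -> R) : bounded_measurable f ->
  bounded_measurable g -> bounded_measurable (fun x => f x * g x).
Proof.
move=> [mf [M fM]] [mg [N gN]]; split; first exact: measurable_funM.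
by exists (M * N) => x; rewrite normrM ler_pM.
Qed.

Lemma bounded_measurable_indic (A : set T) : measurable A ->
  bounded_measurable (\1_A).
Proof.
move=> mA; split; first exact: measurable_indic.
by exists 1 => x; rewrite ger0_norm ?indic_le1.
Qed.

Lemma bounded_measurable_bounded {f : T -> R} : bounded_measurable f ->
  [bounded f x | x in setT].
Proof.
move=> [_ [M fM]]; exists M; split; first exact: num_real.
by move=> N MN x _ /=; rewrite (le_trans (fM x))// ltW.
Qed.

Lemma bounded_measurable_itv (f : T -> R) (a b : R) : measurable_fun setT f ->
  (forall x, a <= f x <= b) -> bounded_measurable f.
Proof.
move=> mf fab; split=> //; exists (`|a| + `|b|) => x.
have /andP[ax xb] := fab x.
rewrite ler_norml; apply/andP; split.
  rewrite (le_trans _ ax)// lerNl (le_trans (ler_norm (- a)))// normrN.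
  by rewrite lerDl.
by rewrite (le_trans xb)// (le_trans (ler_norm b))// lerDr.
Qed.

Context (mu : probability T R).

Lemma bounded_measurable_integrable {D : set T} {f : T -> R} : measurable D ->
  bounded_measurable f -> mu.-integrable D (EFin \o f).
Proof.
move=> mD bf; apply: (@integrableS _ _ _ mu setT) => //.
apply: measurable_bounded_integrable => //; last 2 first.
- exact: bf.1.
- exact: bounded_measurable_bounded.
by rewrite ltey_eq fin_num_measure.
Qed.

Lemma bounded_measurableMintegrable (f g : T -> R) :
  bounded_measurable f -> mu.-integrable setT (EFin \o g) ->
  mu.-integrable setT (EFin \o (fun x => f x * g x)).
Proof.
move=> bf ig; rewrite (_ : _ \o _ = (EFin \o f) \* (EFin \o g))%E; last first.
  by apply/funext => x /=; rewrite EFinM.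
by apply: integrableMr => //; [exact: bf.1|exact: bounded_measurable_bounded].
Qed.

End bounded_measurable.

Section kernel_integral.
Context d (T : measurableType d) (R : realType) (mu : probability T R).
Variables (h : T -> T -> R) (g : T -> R).
Hypothesis bh : bounded_measurable (fun z : T * T => h z.1 z.2).
Hypothesis ig : mu.-integrable setT (EFin \o g).

Lemma bounded_measurable_section1 x : bounded_measurable (h x).
Proof.
case: bh => mh [M hM]; split; last by exists M => y; exact: (hM (x, y)).
exact: (measurable_fun_pair2 x mh).
Qed.

Lemma bounded_measurable_section2 y : bounded_measurable (h ^~ y).
Proof.
case: bh => mh [M hM]; split; last by exists M => x; exact: (hM (x, y)).
exact: (measurable_fun_pair1 y mh).
Qed.

Lemma integrable_kernel :
  (mu \x mu)%E.-integrable setT (fun z : T * T => (h z.1 z.2 * g z.1)%:E).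
Proof.
case: bh => mh [M hM].
have mg : measurable_fun setT g by apply/measurable_EFinP/measurable_int/ig.
have mhg : measurable_fun setT (fun z : T * T => (h z.1 z.2 * g z.1)%:E).
  apply/measurable_EFinP/measurable_funM => //.
  exact: (measurableT_comp mg).
apply: (iffRL (@integrable12ltyP _ _ _ _ _ mu mu _ mhg)).
apply: (@le_lt_trans _ _ (\int[mu]_x (M%:E * `|(g x)%:E|))%E).
  apply: ge0_le_integral => //.
  - by move=> x _; exact: integral_ge0.
  - apply: (measurable_fun_fubini_tonelli_F (m2 := mu)
      (fun z : T * T => `|(h z.1 z.2 * g z.1)%:E|%E)) => //.
    exact: measurableT_comp.
  - apply: emeasurable_funM => //; apply: measurableT_comp => //.
    exact/measurable_EFinP.
  move=> x _ /=.
  apply: (@le_trans _ _ (\int[mu]_y (cst (M * `|g x|)%:E y))%E).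
    apply: ge0_le_integral => //.
    - do 2 apply: measurableT_comp => //; apply: measurable_funM => //.
      exact: (bounded_measurable_section1 x).1.
    by move=> y _; rewrite lee_fin normrM ler_wpM2r//; exact: (hM (x, y)).
  rewrite integral_cst// -EFinM -[leRHS]mule1 lee_wpmul2l ?probability_le1//.
  by rewrite lee_fin mulr_ge0// (le_trans _ (hM (point, point))).
rewrite integralZl//; last exact: integrable_abse.
have /integrableP[_ gfin] := ig.
have M0 : (0 <= M) by rewrite (le_trans _ (hM (point, point))).
have [M_eq0|M_neq0] := eqVneq M 0; first by rewrite M_eq0 mul0e.
by rewrite lte_mul_pinfty// lee_fin.
Qed.

Lemma EFin_Rintegral_section2 y :
  (\int[mu]_x (h x y * g x))%:E = (\int[mu]_x (h x y * g x)%:E)%E.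
Proof.
rewrite fineK//; apply: integrable_fin_num => //.
exact: (bounded_measurableMintegrable (bounded_measurable_section2 y) ig).
Qed.

Lemma integrable_kernel_integral :
  mu.-integrable setT (EFin \o fun y => \int[mu]_x (h x y * g x)).
Proof.
apply: (@eq_integrable _ _ _ mu _ _ (fubini_G mu
    (fun z : T * T => (h z.1 z.2 * g z.1)%:E))) => //.
  by move=> y _; rewrite /= EFin_Rintegral_section2.
have ik := integrable_kernel; have mk := measurable_int _ ik.
have mG := measurable_fubini_G ik.
apply/integrableP; split=> //.
have := (@integrable21ltyP _ _ _ _ _ mu mu _ mk).1 ik; apply: le_lt_trans.
apply: ge0_le_integral => //.
- exact: measurableT_comp.
- apply: (measurable_fun_fubini_tonelli_G (m1 := mu)
    (fun z : T * T => `|(h z.1 z.2 * g z.1)%:E|%E)) => //.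
  exact: measurableT_comp.
- move=> y _; apply: le_abse_integral => //.
  exact: (measurable_fun_pair1 y mk).
Qed.

Lemma kernel_Fubini :
  \int[mu]_x \int[mu]_y (h x y * g x) = \int[mu]_y \int[mu]_x (h x y * g x).
Proof.
have := Fubini integrable_kernel; rewrite /= => E; congr fine.
transitivity (\int[mu]_x \int[mu]_y (h x y * g x)%:E)%E; last first.
  by rewrite E; apply: eq_integral => y _; rewrite EFin_Rintegral_section2.
apply: eq_integral => x _; rewrite fineK//.
apply: integrable_fin_num => //; apply: bounded_measurable_integrable => //.
apply: bounded_measurableM; first exact: bounded_measurable_section1.
exact: bounded_measurable_cst.
Qed.

End kernel_integral.

(** * Doeblin's contraction *)

Section doeblin.
Context d (T : measurableType d) (R : realType) (mu : probability T R).
Variable k : T -> T -> R.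
Hypothesis bk : bounded_measurable (fun z : T * T => k z.1 z.2).
Hypothesis k0 : forall x y, 0 <= k x y.
Hypothesis k1 : forall x, \int[mu]_y k x y = 1.

(** For the Markov chain that jumps from x with density k x, [transfer f] is the
density of the next state when the present one has density f, and [koopman phi]
maps x to the expectation of phi at the next state. *)
Definition transfer (f : T -> R) (y : T) : R := \int[mu]_x (k x y * f x).

Definition koopman (phi : T -> R) (x : T) : R := \int[mu]_y (k x y * phi y).

Lemma transfer_integrable f : mu.-integrable setT (EFin \o f) ->
  mu.-integrable setT (EFin \o transfer f).
Proof. exact: integrable_kernel_integral. Qed.

Let bounded_kernelM phi : bounded_measurable phi ->
  bounded_measurable (fun z : T * T => k z.1 z.2 * phi z.2).
Proof.
move=> [mphi [M phiM]]; apply: bounded_measurableM => //; split.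
  exact: (measurableT_comp mphi).
by exists M => z.
Qed.

Lemma koopman_integrable phi x : bounded_measurable phi ->
  mu.-integrable setT (EFin \o (fun y => k x y * phi y)).
Proof.
move=> bphi; apply: bounded_measurable_integrable => //.
exact: (@bounded_measurable_section1 _ _ _ (fun x y => k x y * phi y)
  (bounded_kernelM bphi)).
Qed.

Lemma Rintegral_le_koopman phi psi x : bounded_measurable phi ->
  bounded_measurable psi -> (forall y, psi y <= k x y * phi y) ->
  \int[mu]_y psi y <= koopman phi x.
Proof.
move=> bphi bpsi psile; apply: le_Rintegral => //.
  exact: bounded_measurable_integrable.
exact: koopman_integrable.
Qed.

Lemma le_koopman phi psi : bounded_measurable phi -> bounded_measurable psi ->
  (forall x, phi x <= psi x) -> forall x, koopman phi x <= koopman psi x.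
Proof.
move=> bphi bpsi phipsi x; rewrite /koopman.
apply: le_Rintegral => //; try exact: koopman_integrable.
by move=> y _; rewrite ler_wpM2l.
Qed.

Lemma koopman_cst c x : koopman (cst c) x = c.
Proof.
rewrite /koopman RintegralZr ?k1 ?mul1r//.
apply: bounded_measurable_integrable => //.
exact: (bounded_measurable_section1 bk x).
Qed.

Lemma koopmanB phi psi x : bounded_measurable phi -> bounded_measurable psi ->
  koopman (fun y => phi y - psi y) x = koopman phi x - koopman psi x.
Proof.
move=> bphi bpsi; rewrite /koopman -RintegralB//; try exact: koopman_integrable.
by apply: eq_Rintegral => y _; rewrite mulrBr.
Qed.

Lemma koopman_itv phi a b : bounded_measurable phi ->
  (forall x, a <= phi x <= b) -> forall x, a <= koopman phi x <= b.
Proof.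
move=> bphi phiab x; apply/andP; split.
  rewrite -[leLHS](koopman_cst a x); apply: le_koopman => //.
    exact: bounded_measurable_cst.
  by move=> y; have /andP[] := phiab y.
rewrite -[leRHS](koopman_cst b x); apply: le_koopman => //.
  exact: bounded_measurable_cst.
by move=> y; have /andP[] := phiab y.
Qed.

Lemma bounded_measurable_koopman phi : bounded_measurable phi ->
  bounded_measurable (koopman phi).
Proof.
move=> bphi; split.
  have ik := bounded_measurable_integrable (mu \x mu)%E measurableT
    (bounded_kernelM bphi).
  apply/measurable_EFinP; apply: eq_measurable_fun (measurable_fubini_F ik).
  move=> x _; rewrite /fubini_F/= /koopman /Rintegral fineK//.
  by apply: integrable_fin_num => //; exact: koopman_integrable.
case: (bphi) => _ [M phiM]; exists M => x; rewrite ler_norml.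
by apply: koopman_itv => // y; rewrite -ler_norml.
Qed.

Lemma bounded_measurable_iter_koopman n phi : bounded_measurable phi ->
  bounded_measurable (iter n koopman phi).
Proof. by move=> bphi; elim: n => //= n; exact: bounded_measurable_koopman. Qed.

Lemma iter_koopman_itv n phi a b : bounded_measurable phi ->
  (forall x, a <= phi x <= b) -> forall x, a <= iter n koopman phi x <= b.
Proof.
move=> bphi phiab; elim: n => //= n IHn; apply: koopman_itv => //.
exact: bounded_measurable_iter_koopman.
Qed.

Lemma iter_koopman_ge0 n phi : (forall x, 0 <= phi x) ->
  forall x, 0 <= iter n koopman phi x.
Proof.
move=> phi0; elim: n => //= n IHn x.
by apply: Rintegral_ge0 => y _; rewrite mulr_ge0.
Qed.

Lemma iter_koopmanB n phi psi : bounded_measurable phi ->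
  bounded_measurable psi ->
  iter n koopman (fun y => phi y - psi y) =
  (fun x => iter n koopman phi x - iter n koopman psi x).
Proof.
move=> bphi bpsi; elim: n => //= n ->; apply/funext => x.
by rewrite koopmanB//; exact: bounded_measurable_iter_koopman.
Qed.

Lemma iter_koopman_cst n c : iter n koopman (cst c) = cst c.
Proof.
by elim: n => //= n ->; apply/funext => x; exact: koopman_cst.
Qed.

(** By Fubini: both sides are the integral of k x y * phi y * f x. *)
Lemma transfer_koopman f phi : mu.-integrable setT (EFin \o f) ->
  bounded_measurable phi ->
  \int[mu]_y (phi y * transfer f y) = \int[mu]_x (koopman phi x * f x).
Proof.
move=> fi bphi.
have bkphi := bounded_kernelM bphi.
transitivity (\int[mu]_y \int[mu]_x (k x y * phi y * f x)).
  apply: eq_Rintegral => y _; rewrite -RintegralZl//; last first.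
    apply: bounded_measurableMintegrable => //.
    exact: (bounded_measurable_section2 bk y).
  by apply: eq_Rintegral => x _; rewrite mulrCA mulrA.
rewrite -kernel_Fubini//; apply: eq_Rintegral => x _.
by rewrite -RintegralZr//; exact: koopman_integrable.
Qed.

Lemma iter_transfer_integrable n f : mu.-integrable setT (EFin \o f) ->
  mu.-integrable setT (EFin \o iter n transfer f).
Proof. by move=> fi; elim: n => //= n; exact: transfer_integrable. Qed.

Lemma iter_transfer_koopman n f phi : mu.-integrable setT (EFin \o f) ->
  bounded_measurable phi ->
  \int[mu]_y (phi y * iter n transfer f y) =
  \int[mu]_x (iter n koopman phi x * f x).
Proof.
move=> fi; elim: n phi => //= n IHn phi bphi.
rewrite transfer_koopman//; last exact: iter_transfer_integrable.
rewrite IHn; last exact: bounded_measurable_koopman.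
by rewrite -iterS iterSr.
Qed.

Variables (N : nat) (J : set T) (kappa : R).
Hypothesis N0 : (0 < N)%N.
Hypothesis mJ : measurable J.
Hypothesis J0 : 0 < fine (mu J).
Hypothesis kappa0 : 0 < kappa.
Hypothesis minorization : forall phi, bounded_measurable phi ->
  (forall x, 0 <= phi x) ->
  forall x, kappa * \int[mu]_(y in J) phi y <= iter N koopman phi x.

Let r := 1 - kappa * fine (mu J).

Let r_itv : 0 <= r < 1.
Proof.
rewrite /r; have := minorization (bounded_measurable_cst _ 1) (fun=> ler01).
move=> /(_ point); rewrite iter_koopman_cst/= Rintegral_cst// mul1r => ?.
have : 0 < kappa * fine (mu J) by exact: mulr_gt0.
by lra.
Qed.

(** The minorization applied to phi - a raises the lower bound a, and applied to
b - phi it lowers the upper bound b.  The two gains add up to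
kappa * mu J * (b - a), whatever the values of phi on J. *)
Lemma osc_koopman_step phi a b : bounded_measurable phi ->
  (forall x, a <= phi x <= b) ->
  exists a' b', b' - a' = r * (b - a) /\
    forall x, a' <= iter N koopman phi x <= b'.
Proof.
move=> bphi phiab; have bc c := bounded_measurable_cst T (c : R).
exists (a + kappa * \int[mu]_(y in J) (phi y - a)).
exists (b - kappa * \int[mu]_(y in J) (b - phi y)); split.
  have iJ g : bounded_measurable g -> mu.-integrable J (EFin \o g).
    exact: bounded_measurable_integrable.
  rewrite !RintegralB//; try exact: iJ; try exact: (iJ _ (bc _)).
  by rewrite !Rintegral_cst// /r; ring.
move=> x.
have := @minorization (fun y => phi y - cst a y) (bounded_measurableB bphi (bc a)).
have := @minorization (fun y => cst b y - phi y) (bounded_measurableB (bc b) bphi).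
rewrite !iter_koopmanB// !iter_koopman_cst/= => Hb Ha.
have {}Hb := Hb _ x; have {}Ha := Ha _ x.
apply/andP; split.
  rewrite addrC -lerBrDr; apply: Ha => y.
  by rewrite subr_ge0; have /andP[] := phiab y.
rewrite lerBrDr addrC -lerBrDr; apply: Hb => y.
by rewrite subr_ge0; have /andP[] := phiab y.
Qed.

Lemma osc_koopman q phi a b : bounded_measurable phi ->
  (forall x, a <= phi x <= b) ->
  exists a' b', b' - a' = r ^+ q * (b - a) /\
    forall x, a' <= iter (q * N) koopman phi x <= b'.
Proof.
move=> bphi phiab; elim: q => [|q [a' [b' [ab' H]]]].
  by exists a, b; rewrite expr0 mul1r.
have [|a2 [b2 [ab2 H2]]] := osc_koopman_step _ H.
  exact: bounded_measurable_iter_koopman.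
exists a2, b2; split; first by rewrite ab2 ab' mulrA exprS.
by move=> x; rewrite mulSn iterD.
Qed.

(** The norm is the integral against the sign phi of the iterate, hence by duality
the integral of f against an iterate of phi.  As f has mean zero, the latter may
be centred at the midpoint of its range, after which it is bounded by half of its
oscillation. *)
Lemma norm_iter_transfer_le n f : mu.-integrable setT (EFin \o f) ->
  \int[mu]_x f x = 0 ->
  \int[mu]_x `|iter n transfer f x| <= r ^+ (n %/ N) * \int[mu]_x `|f x|.
Proof.
move=> fi f0; have fni := iter_transfer_integrable n fi.
have mF : measurable_fun setT (iter n transfer f).
  exact/measurable_EFinP/(measurable_int mu).
pose phi x : R := if 0 <= iter n transfer f x then 1 else -1.
have phi1 x : -1 <= phi x <= 1 by rewrite /phi; case: ifP => _; lra.
have bphi : bounded_measurable phi.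
  apply: bounded_measurable_itv phi1.
  by apply: measurable_fun_ifT => //; exact: measurable_fun_ler.
have bc (c : R) := bounded_measurable_cst T c.
have -> : \int[mu]_x `|iter n transfer f x| =
    \int[mu]_x (phi x * iter n transfer f x).
  apply: eq_Rintegral => x _; rewrite /phi; case: ifPn => [?|].
    by rewrite ger0_norm// mul1r.
  by rewrite -ltNge => /ltW ?; rewrite ler0_norm// mulN1r.
(* the n %% N steps that do not fill a block preserve the bounds -1 and 1 *)
rewrite iter_transfer_koopman// {1}(divn_eq n N).
have [||a [b [abr H]]] :=
    @osc_koopman (n %/ N) (iter (n %% N) koopman phi) (-1) 1.
- exact: bounded_measurable_iter_koopman.
- exact: iter_koopman_itv.
rewrite iterD; set psi := iter _ _ _ in H *.
have bpsi : bounded_measurable psi by do 2 apply: bounded_measurable_iter_koopman.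
pose c := (a + b) / 2.
have -> : \int[mu]_x (psi x * f x) = \int[mu]_x ((psi x - cst c x) * f x).
  transitivity (\int[mu]_x (psi x * f x) - \int[mu]_x (cst c x * f x)).
    by rewrite RintegralZl// f0 mulr0 subr0.
  rewrite -RintegralB//; try exact: bounded_measurableMintegrable.
  by apply: eq_Rintegral => x _; rewrite mulrBl.
have bpsic : bounded_measurable (fun x => psi x - cst c x).
  exact: bounded_measurableB.
have psii : mu.-integrable setT (EFin \o (fun x => (psi x - cst c x) * f x)).
  exact: bounded_measurableMintegrable.
rewrite (le_trans (ler_norm _))// (le_trans (le_normr_Rintegral _ psii))//.
rewrite -RintegralZl//; last exact: integrable_norm.
apply: le_Rintegral => //; first exact: (integrable_norm psii).
  exact: (bounded_measurableMintegrable (bc _) (integrable_norm fi)).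
move=> x _; rewrite normrM ler_wpM2r// ler_norml /= /c.
by have /andP[] := H x; lra.
Qed.

Theorem doeblin_decay f : mu.-integrable setT (EFin \o f) ->
  \int[mu]_x f x = 0 ->
  \int[mu]_x `|iter n transfer f x| @[n --> \oo] --> 0.
Proof.
move=> fi f0; have /andP[r0 r1] := r_itv.
apply: (@squeeze_cvgr _ _ _ _ (cst 0)
    (fun n => r ^+ (n %/ N) * \int[mu]_x `|f x|)).
- near=> n; rewrite norm_iter_transfer_le// andbT.
  exact: Rintegral_ge0.
- exact: cvg_cst.
rewrite -[X in _ --> X](mul0r (\int[mu]_x `|f x|)); apply: cvgMl.
apply: (@cvg_comp _ _ _ (fun n => n %/ N)%N (fun n => r ^+ n) _ \oo).
  apply/cvgnyPge => A; exists (A * N)%N => // n /=.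
  by rewrite leq_divRL.
by apply: cvg_expr; rewrite ger0_norm.
Unshelve. all: by end_near. Qed.

End doeblin.

(** * Preimages of null sets *)

Section null_preimage.
Context (R : realType).
Local Notation mu := (@lebesgue_measure R).
Local Notation l := (@wlength R idfun).

(** On S the map phi has a Lipschitz inverse, so that the part of S mapped into an
interval of length d lies in an interval of length proportional to d; covers of A
by short intervals thus yield covers of the preimage. *)
Lemma negligible_preimage_lipschitz (S A : set R) (phi : R -> R) (c : R) :
  (forall x y, S x -> S y -> `|x - y| <= c * `|phi x - phi y|) ->
  mu.-negligible A -> mu.-negligible (S `&` phi @^-1` A).
Proof.
move=> Hc /negligible_outer_measure A0; apply/negligible_outer_measure.
apply/eqP; rewrite eq_le outer_measure_ge0 andbT.
apply/lee_addgt0Pr => e e0; rewrite add0e.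
(* |c| + 1 instead of c makes the radius of the balls below positive *)
pose C := (`|c| + 1) * 2.
have C0 : 0 < C by rewrite mulr_gt0// ltr_wpDl.
have eC : 0 < e / C by rewrite divr_gt0.
have [F [Fitv AF] Fe] : exists2 F, open_itv_cover A F &
    (\sum_(0 <= k <oo) l (F k) <= (e / C)%:E)%E.
  have : (l^* A)%mu \is a fin_num by rewrite A0.
  rewrite outer_measure_open_itv_cover.
  move=> /lb_ereal_inf_adherent-/(_ _ eC)[_/= [F]] AF <- Fe.
  exists F => //; rewrite ltW// (lt_le_trans Fe)//.
  by rewrite -outer_measure_open_itv_cover A0 add0e.
have /choice[G HG] : forall i, exists B : set R,
    S `&` phi @^-1` (F i) `<=` B /\ ((l^* B)%mu <= C%:E * l (F i))%E.
  move=> i; have [ab Fab] := Fitv i.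
  have [->|/set0P[x [Sx Fx]]] := eqVneq (S `&` phi @^-1` (F i)) set0.
    by exists set0; split=> //; rewrite outer_measure0 mule_ge0// ?lee_fin ?(ltW C0).
  have ab12 : ab.1 < ab.2.
    by move: Fx; rewrite Fab/= in_itv/= => /andP[]; exact: lt_trans.
  exists (ball x ((`|c| + 1) * (ab.2 - ab.1))); split.
    move=> y [Sy Fy]; apply: (@le_lt_trans _ _ (`|c| * (ab.2 - ab.1))).
      rewrite (le_trans (Hc _ _ Sx Sy))// (le_trans (ler_wpM2r _ (ler_norm c)))//.
      rewrite ler_wpM2l// ler_distlC.
      move: Fx Fy; rewrite Fab/= !in_itv/= => /andP[? ?] /andP[? ?].
      by apply/andP; split; lra.
    by rewrite ltr_pM2r ?subr_gt0// ltrDl.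
  have -> : (l^* (ball x ((`|c| + 1) * (ab.2 - ab.1))))%mu =
      lebesgue_measure (ball x ((`|c| + 1) * (ab.2 - ab.1))) by [].
  rewrite lebesgue_measure_ball; last first.
    by apply: mulr_ge0; [exact: addr_ge0|rewrite subr_ge0 ltW].
  rewrite Fab wlength_itv/= lte_fin ab12 -EFinD -EFinM lee_fin /C.
  by rewrite -[leLHS]mulr_natr mulrAC.
apply: (@le_trans _ _ (l^* (\bigcup_i G i))%mu).
  apply: le_outer_measure => x [Sx Ax]; have [i _ Fi] := AF _ Ax.
  by exists i => //; apply: (HG i).1.
apply: (le_trans (outer_measure_sigma_subadditive (l^*)%mu G)).
apply: (@le_trans _ _ (\sum_(0 <= k <oo) C%:E * l (F k))%E).
  by apply: lee_nneseries => // i _; exact: (HG i).2.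
rewrite nneseriesZl; last by move=> i _; exact: wlength_ge0.
  rewrite (le_trans (lee_wpmul2l _ Fe))// ?lee_fin ?(ltW C0)//.
  by rewrite mulrC divfK// gt_eqF.
Qed.

(** At a point where the derivative is nonzero, phi separates x from all points at
distance less than 1 / n.+1 at a rate 1 / n.+1, for some n; S n is the set of
these points.  Cut into pieces P n j shorter than 1 / n.+1, it satisfies the
hypothesis of [negligible_preimage_lipschitz]. *)
Lemma negligible_preimage (A : set R) (phi dphi : R -> R) :
  (forall x : R, is_derive x 1 phi (dphi x)) -> mu.-negligible A ->
  mu.-negligible ([set x | dphi x != 0] `&` phi @^-1` A).
Proof.
move=> dphiE A0.
pose S n := [set x : R | forall y, `|x - y| * n.+1%:R < 1 ->
   `|x - y| <= n.+1%:R * `|phi x - phi y|].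
pose P (n j : nat) := [set x : R | if unpickle j is Some z
  then Num.floor (x * n.+1%:R) = z else False].
apply: (@negligibleS _ _ _ mu
    (\bigcup_n \bigcup_j ((S n `&` P n j) `&` phi @^-1` A))); last first.
  apply: negligible_bigcup => n; apply: negligible_bigcup => j.
  apply: (negligible_preimage_lipschitz (c := n.+1%:R)) A0.
  move=> x y [Sx +] [Sy +]; rewrite /P/=; case: unpickle => // z zx zy.
  apply: Sx; have := floor_itv (x * n.+1%:R); have := floor_itv (y * n.+1%:R).
  rewrite zx zy intrD => /andP[? ?] /andP[? ?].
  have n0 : 0 < n.+1%:R :> R by [].
  rewrite -[X in _ * X](gtr0_norm n0) -normrM ltr_norml; apply/andP; split; lra.
move=> x [/= dx0 Ax].
have : exists n, S n x.
  have [ex dv] := dphiE x.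
  have lim0 : 0 < `|'D_1 phi x| / 2.
    by rewrite divr_gt0// normr_gt0 dv.
  have : `|'D_1 phi x| / 2 < `|'D_1 phi x| by lra.
  move=> /(cvgr_norm_gt _ ex)/nbhs_ballP[delta /= delta0 Hdelta].
  set D := `|'D_1 phi x| / 2 in lim0 Hdelta.
  pose n := Num.truncn (delta^-1 + D^-1).
  have nlt : delta^-1 + D^-1 < n.+1%:R by rewrite /n truncnS_gt.
  exists n => y xyn.
  have [->|xy] := eqVneq x y.
    by rewrite !subrr !normr0 mulr0.
  have n0 : 0 < n.+1%:R :> R by [].
  have xyd : `|x - y| < delta.
    rewrite -(ltr_pM2r n0) (lt_trans xyn)// -ltr_pdivrMl// mulr1.
    by rewrite (le_lt_trans _ nlt)// lerDl invr_ge0 ltW.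
  have yx0 : ball (0 : R) delta (y - x).
    by rewrite /ball/= sub0r normrN distrC.
  have /= := Hdelta _ yx0.
  rewrite subr_eq0 eq_sym => /(_ xy).
  rewrite [_%:A]mulr1 subrK normrM normfV distrC [`|phi y - _|]distrC.
  rewrite ltr_pdivlMl ?normr_gt0 ?subr_eq0// => H.
  have : 1 <= n.+1%:R * D.
    rewrite -ler_pdivrMr// mul1r (le_trans _ (ltW nlt))// lerDr invr_ge0.
    exact: ltW.
  move=> nD1; apply: (@le_trans _ _ (n.+1%:R * (`|x - y| * D))).
    by rewrite mulrCA ler_peMr.
  by rewrite ler_pM2l// ltW.
move=> [n Sn]; pose z := Num.floor (x * n.+1%:R).
have [j jz] : exists j, unpickle j = Some z by exists (pickle z); exact: pickleK.
by exists n => //; exists j => //; split=> //; split=> //; rewrite /P/= jz.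
Qed.

End null_preimage.

(** * Densities of pushforward measures on the circle *)

Section haar.
Context (R : realType).

Lemma haarE (A : set R) : measurable A ->
  haar R A = lebesgue_measure (A `&` `[0, 1]).
Proof.
move=> mA; rewrite /haar /= /uniform_prob integral_uniform_pdf.
rewrite (eq_integral (cst 1%E)) ?integral_cst ?mul1e//; first exact: measurableI.
move=> x; rewrite inE => -[_]; rewrite /= in_itv/= /uniform_pdf => ->.
by rewrite subr0 invr1.
Qed.

Definition fracpart (x : R) : R := x - (Num.floor x)%:~R.

Lemma fracpart_itv x : 0 <= fracpart x < 1.
Proof. by rewrite /fracpart; have := floor_itv x; rewrite intrD; lra. Qed.

Lemma fracpart_id x : 0 <= x < 1 -> fracpart x = x.
Proof.
by move=> /andP[x0 x1]; rewrite /fracpart (@floor_def _ _ 0) ?subr0// x0.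
Qed.

Lemma measurable_fracpart : measurable_fun setT fracpart.
Proof.
apply: measurable_funB => //; apply: nondecreasing_measurable => // x y xy.
by rewrite ler_int le_floor.
Qed.

Lemma periodic_int (f : R -> R) (k : int) x : periodic f 1 -> f (x + k%:~R) = f x.
Proof.
move=> pf; case: k => n.
  by elim: n => [|n IHn]; rewrite ?addr0// -addn1 PoszD intrD addrA pf.
rewrite NegzE; elim: (n.+1) => [|m IHm]; first by rewrite oppr0 addr0.
by rewrite -IHm -addn1 PoszD opprD intrD -[in LHS]pf addrA subrK.
Qed.

Lemma periodic_set_int (A : set R) (k : int) x : periodic_set A ->
  A (x + k%:~R) <-> A x.
Proof.
move=> pA.
have pAn (n : nat) y : A (y + n%:R) <-> A y.
  elim: n => [|n IHn]; first by rewrite addr0.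
  by rewrite -natr1 addrA pA.
case: k => n; first exact: pAn.
by rewrite NegzE -(pAn n.+1 (x + _)) intrN subrK.
Qed.

Lemma periodic_set_fracpart (A : set R) x : periodic_set A ->
  A (fracpart x) <-> A x.
Proof. by move=> pA; rewrite -(periodic_set_int (Num.floor x) _ pA) subrK. Qed.

Lemma haar_ae_fracpart : {ae haar R, forall x, fracpart x = x}.
Proof.
exists (~` `[0, 1[); split => //.
- exact: measurableC.
- rewrite haarE; last exact: measurableC.
  rewrite (_ : _ `&` _ = [set 1]) ?lebesgue_measure_set1//.
  apply/seteqP; split => [x []|x /= ->]; last first.
    by rewrite !in_itv/= ler01 lexx ltxx.
  rewrite /= !in_itv/= => x01 /andP[x0 x1]; apply/eqP.
  by rewrite eq_le x1/= leNgt; apply/negP => xlt1; apply: x01; rewrite x0.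
- by move=> x /= + x01; apply; apply: fracpart_id; move: x01; rewrite /= in_itv.
Qed.

End haar.

Section pushforward_density_exists.
Context (R : realType).
Variable T : R -> R.
Hypothesis mT : measurable_fun setT T.
Hypothesis nonsingular : forall A : set R, lebesgue_measure.-negligible A ->
  lebesgue_measure.-negligible (T @^-1` A).

Let S : measurableTypeR R -> measurableTypeR R := @fracpart R \o T.

Let mS : measurable_fun setT S.
Proof. exact: (measurableT_comp (@measurable_fracpart R) mT). Qed.

(** T x has its fractional part in A only when T x lies in one of the countably many
integer translates of the trace of A on [0, 1], which are all null. *)
Lemma negligible_preimage_fracpart (A : set R) : measurable A ->
  haar R A = 0%E -> haar R (S @^-1` A) = 0%E.
Proof.
move=> mA; rewrite haarE// => A0.
have mI : measurable (`[0, 1] : set R) by exact: measurable_itv.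
have A01 : lebesgue_measure.-negligible (A `&` `[0, 1]).
  by exists (A `&` `[0, 1]); split=> //; exact: measurableI.
have Ak k : lebesgue_measure.-negligible ((fun y => y - k) @^-1` (A `&` `[0, 1])).
  rewrite -[X in lebesgue_measure.-negligible X]setTI.
  apply: (negligible_preimage_lipschitz (c := 1)) A01 => x y _ _.
  by rewrite mul1r opprB addrA subrK.
have [N [mN N0 SN]] : lebesgue_measure.-negligible (S @^-1` A).
  apply: (@negligibleS _ _ _ lebesgue_measure
    (\bigcup_n (T @^-1` ((fun y => y - (if unpickle n is Some z then z%:~R else 0))
      @^-1` (A `&` `[0, 1])))) (S @^-1` A)).
    move=> x Ax; exists (pickle (Num.floor (T x))) => //=.
    rewrite pickleK; split=> //; rewrite in_itv/=.
    by have /andP[-> /ltW] := fracpart_itv (T x).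
  by apply: negligible_bigcup => n; exact: nonsingular.
have mSA : measurable (S @^-1` A) by rewrite -[X in measurable X]setTI; exact: mS.
by rewrite haarE//; apply: (subset_measure0 _ mN _ N0);
  [exact: measurableI|move=> x [/SN]].
Qed.

(** The map S sends the fundamental domain to itself, so that the Radon-Nikodym
theorem applies to the image by S of the signed measure of density f.  The
density so obtained is made periodic by composition with [fracpart], which does
not change it on [0, 1[. *)
Lemma pushforward_density_exists f : circle_L1 f ->
  exists h, pushforward_density T f h.
Proof.
move=> [pf fi].
pose nu :=
  measure_function_pushforward__canonical__charge_Charge (induced_charge fi) mS.
have nuE A : nu A = (\int[haar R]_(x in S @^-1` A) (f x)%:E)%E by [].
have mSA A : measurable A -> measurable (S @^-1` A).
  by move=> mA; rewrite -[X in measurable X]setTI; exact: mS.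
have numu : nu `<< haar R.
  apply/null_content_dominatesP => A mA A0.
  rewrite nuE null_set_integral//.
  - exact: mSA.
  - by apply: measurable_funTS; exact: measurable_int fi.
  - exact: negligible_preimage_fracpart.
pose h0 := fine \o Radon_Nikodym nu (haar R).
have h0E : EFin \o h0 = Radon_Nikodym nu (haar R).
  by apply/funext => x /=; rewrite fineK// Radon_Nikodym_fin_num.
have h0i : (haar R).-integrable setT (EFin \o h0).
  by rewrite h0E; exact: Radon_Nikodym_integrable.
have mh0 : measurable_fun setT (EFin \o h0) by exact: measurable_int h0i.
have mh : measurable_fun setT (EFin \o (h0 \o @fracpart R)).
  exact: (measurableT_comp mh0 (@measurable_fracpart R)).
have hh0 D : ae_eq (haar R) D (EFin \o (h0 \o @fracpart R)) (EFin \o h0).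
  have [N [mN N0 fN]] := haar_ae_fracpart R; exists N; split=> //.
  by apply: subset_trans fN; apply: subsetC => x /= ->.
exists (h0 \o @fracpart R); split.
  split.
    move=> x /=; congr h0; rewrite /fracpart floorDrz// intrD floor1.
    by rewrite opprD addrACA subrr addr0.
  apply/integrableP; split=> //.
  have /integrableP[_] := h0i; apply: le_lt_trans.
  rewrite le_eqVlt; apply/orP; left; apply/eqP.
  apply: ae_eq_integral => //; try exact: measurableT_comp.
  have [N [mN N0 fN]] := haar_ae_fracpart R; exists N; split=> //.
  by apply: subset_trans fN; apply: subsetC => x /= ->.
move=> A mA pA.
transitivity (\int[haar R]_(y in A) (EFin \o h0) y)%E.
  by apply: ae_eq_integral => //; exact: measurable_funTS.
transitivity (nu A); first by rewrite h0E -Radon_Nikodym_integral.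
rewrite nuE; congr (integral _ _ _); apply/seteqP; split => x /=;
  by move/(periodic_set_fracpart _ pA).
Qed.

End pushforward_density_exists.

(** * Numerical estimates on sine and cosine *)

Section trigonometry.
Context (R : realType).
Implicit Types x : R.

Lemma le_of_derive_ge0 (f df : R -> R) (x : R) :
  (forall y : R, is_derive y 1 f (df y)) ->
  (forall y, 0 <= y <= x -> 0 <= df y) -> 0 <= x -> f 0 <= f x.
Proof.
move=> fdf df0 x0.
have cf : {within `[0, x], continuous f}.
  apply: continuous_subspaceT => y; apply: differentiable_continuous.
  by apply/derivable1_diffP; case: (fdf y).
have [c /[!in_itv]/= cx E] := MVT_segment x0 (fun y _ => fdf y) cf.
by rewrite -subr_ge0 E subr0 mulr_ge0// df0.
Qed.

Lemma sin_le x : 0 <= x -> sin x <= x.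
Proof.
move=> x0; rewrite -subr_ge0 -[leLHS](subr0 0) -{2}(@sin0 R).
by apply: (@le_of_derive_ge0 (fun y => y - sin y) (fun y => 1 - cos y)).
Qed.

Lemma cos_ge x : 0 <= x -> 1 - x ^+ 2 / 2 <= cos x.
Proof.
move=> x0; rewrite -subr_ge0.
have := @le_of_derive_ge0 (fun y => cos y - (1 - y ^+ 2 / 2))
  (fun y => - sin y + y) x.
rewrite cos0 expr0n/= mul0r subr0 subrr; apply=> // y.
  by apply: is_derive_eq; rewrite /GRing.scale/= ?mulr1; lra.
by move=> /andP[y0 _]; have := sin_le y0; lra.
Qed.

Lemma sin_ge x : 0 <= x -> x - x ^+ 3 / 6 <= sin x.
Proof.
move=> x0; rewrite -subr_ge0.
have := @le_of_derive_ge0 (fun y => sin y - (y - y ^+ 3 / 6))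
  (fun y => cos y - (1 - y ^+ 2 / 2)) x.
rewrite sin0 expr0n/= mul0r !subr0; apply=> // y.
  by apply: is_derive_eq; rewrite /GRing.scale/= ?mulr1; lra.
by move=> /andP[y0 _]; have := cos_ge y0; lra.
Qed.

Lemma cos_piquarter : 2 * cos (pi / 4 : R) ^+ 2 = 1.
Proof.
have := cos_mulr2n (pi / 4 : R).
rewrite (_ : (pi / 4) *+ 2 = pi / 2); last by rewrite -mulr_natr; field.
rewrite cos_pihalf; lra.
Qed.

Lemma sin_piquarter : sin (pi / 4 : R) = cos (pi / 4).
Proof.
by rewrite -cosBpihalf -cosN; congr cos; field.
Qed.

Lemma cos_piquarter_gt0 : 0 < cos (pi / 4 : R).
Proof. by apply: cos_gt0_pihalf; have := @pi_gt0 R; lra. Qed.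

(** If pi / 4 were smaller than 0.765, then [cos_ge] would make the square of
cos (pi / 4) larger than 1 / 2. *)
Lemma pi_ge : 306 / 100 <= pi :> R.
Proof.
rewrite leNgt; apply/negP => pi_lt.
have pi0 := @pi_gt0 R.
have := @cos_ge (pi / 4); have := cos_piquarter.
set c := cos _; have : (pi / 4) ^+ 2 <= (765 / 1000) ^+ 2 :> R.
  by rewrite ler_sqr ?nnegrE; lra.
move=> H1 H2 H3; have {}H3 : 707 / 1000 + 3 / 10000 <= c by lra.
nra.
Qed.

(** If pi / 4 were larger than 0.825, then [sin_ge] would make the square of
sin (pi / 4) larger than 1 / 2. *)
Lemma pi_le : pi <= 33 / 10 :> R.
Proof.
rewrite leNgt; apply/negP => pi_gt.
have pi0 := @pi_gt0 R.
have pi4 : pi < 4 :> R by have := @pihalf_lt2 R; lra.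
have := @sin_ge (pi / 4); rewrite sin_piquarter.
have := cos_piquarter; have := cos_piquarter_gt0; set c := cos _ => c0 c2 H.
have {}H : 73 / 100 <= c.
  have pi40 : 0 <= pi / 4 :> R by lra.
  apply: le_trans (H pi40); set q := pi / 4.
  have q1 : 825 / 1000 < q by rewrite /q; lra.
  have q2 : q < 1 by rewrite /q; lra.
  (* q ^+ 3 lies below its chord over [0.825, 1] *)
  have : 0 <= (q - 825 / 1000) * (1 - q) * (q + 1825 / 1000).
    by rewrite !mulr_ge0; lra.
  lra.
nra.
Qed.

(** The right-hand side is the tangent of the left-hand side at 0.  On the negative
side the difference is monotone, as cos y + sin y >= 1 in the first quadrant. *)
Lemma cosDsin_le x : - (pi / 4) <= x -> cos x + sin x <= 1 + x.
Proof.
have [x0 _|x0 xpi] := leP 0 x; first by rewrite lerD ?cos_le1 ?sin_le.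
have := @le_of_derive_ge0 (fun y => sin y - cos y - y)
  (fun y => cos y + sin y - 1) (- x).
rewrite sin0 cos0 sinN cosN => H.
suff : 0 - 1 - 0 <= - sin x - cos x - - x by lra.
apply: H => [y|y /andP[y0 yx]|]; last by lra.
  by apply: is_derive_eq; lra.
have c0 : 0 <= cos y by apply: cos_ge0_pihalf; have := @pi_gt0 R; lra.
have s0 : 0 <= sin y by apply: sin_ge0_pi; have := @pi_gt0 R; lra.
have := cos_le1 y; have := sin_le1 y; have := cos2Dsin2 y; nra.
Qed.

(** The minimum is reached where sin x = 10 / 14, beyond pi / 2; up to pi / 2 the
crude bound [cos_ge] is enough.  Beyond, with v = x - pi / 2, the term
cos x = - sin v is bounded with the tangent of the sine at pi / 4, whose slope
cos (pi / 4) is slightly less than 10 / 14: the resulting lower bound is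
increasing in v and it suffices to evaluate it at v = 0. *)
Lemma addM_cos_ge x : 0 <= x -> 42 / 100 * pi <= x + 14 / 10 * cos x.
Proof.
move=> x0; have pi3 := pi_ge; have pi33 := pi_le.
have [xpi|xpi] := leP x (pi / 2).
  have c0 : 0 <= cos x by apply: cos_ge0_pihalf; lra.
  have [?|?] := leP (42 / 100 * pi) x; first by lra.
  have := cos_ge x0; nra.
have [v v0 ->] : exists2 v, 0 < v & x = v + pi / 2.
  by exists (x - pi / 2); rewrite ?subrK ?subr_gt0.
rewrite cosDpihalf.
have -> : sin v = cos (pi / 4) * (cos (v - pi / 4) + sin (v - pi / 4)).
  rewrite -{1}(subrK (pi / 4) v) sinD sin_piquarter; ring.
have := @cosDsin_le (v - pi / 4); have := cos_piquarter.
have := cos_piquarter_gt0; set c := cos (pi / 4).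
set w := cos _ + _ => c0 c2 /(_ ltac:(lra)) wle.
have cle : 14 / 10 * c <= 99 / 100 by nra.
have : 14 / 10 * (c * w) <= 99 / 100 * (1 + (v - pi / 4)) by nra.
lra.
Qed.

End trigonometry.

(** * The Arnold map *)

Section arnold.
Context (R : realType).
Variables tau epsilon : R.
Local Notation T := (arnold_map tau epsilon).

Let pi0 : pi != 0 :> R.
Proof. by rewrite gt_eqF// pi_gt0. Qed.

Lemma is_derive_arnold (x : R) : is_derive x 1 T (1 - epsilon * cos (2 * pi * x)).
Proof.
rewrite /arnold_map; apply: is_derive_eq; rewrite /GRing.scale/=.
by have := pi0; move: (@pi R) => p p0; field.
Qed.

Lemma is_derive_arnold' (x : R) : is_derive x 1
  (fun y => 1 - epsilon * cos (2 * pi * y)) (2 * pi * epsilon * sin (2 * pi * x)).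
Proof. by apply: is_derive_eq; rewrite /GRing.scale/=; ring. Qed.

(** [negligible_preimage] handles the points where T' does not vanish.  Applied to
T' and the set {0}, it also handles the critical points: where T' and T'' both
vanish, |cos| = 1 and hence |epsilon| = 1. *)
Lemma negligible_preimage_arnold (A : set R) : `|epsilon| != 1 ->
  lebesgue_measure.-negligible A -> lebesgue_measure.-negligible (T @^-1` A).
Proof.
move=> eps1 A0.
pose dT x := 1 - epsilon * cos (2 * pi * x).
pose ddT x := 2 * pi * epsilon * sin (2 * pi * x).
apply: (@negligibleS _ _ _ lebesgue_measure
  (([set x | dT x != 0] `&` T @^-1` A) `|`
   ([set x | ddT x != 0] `&` dT @^-1` [set 0]))).
  move=> x Ax; have [dTx|dTx] := eqVneq (dT x) 0; last by left.
  right; split=> //=; apply/eqP; rewrite /ddT => ddTx.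
  have e0 : epsilon != 0.
    by apply/eqP => e0; move: dTx; rewrite /dT e0 mul0r subr0 => /eqP; rewrite oner_eq0.
  have /sin0cos1 c1 : sin (2 * pi * x) = 0.
    by move/eqP: ddTx; rewrite !mulf_eq0 (negbTE pi0) (negbTE e0) pnatr_eq0/= => /eqP.
  move: dTx => /eqP; rewrite subr_eq0 => /eqP /(congr1 Num.norm).
  by rewrite normrM c1 mulr1 normr1 => /esym/eqP; exact/negP.
apply: negligibleU; first exact: negligible_preimage is_derive_arnold A0.
apply: negligible_preimage is_derive_arnold' _.
by exists [set 0]; split=> //; rewrite lebesgue_measure_set1.
Qed.

Lemma measurable_arnold : measurable_fun setT T.
Proof.
apply: continuous_measurable_fun => x; apply: differentiable_continuous.
by apply/derivable1_diffP; case: (is_derive_arnold x).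
Qed.

Lemma arnoldDint x (k : int) : T (x + k%:~R) = T x + k%:~R.
Proof.
rewrite /arnold_map.
have : periodic (fun y : R => sin (2 * pi * y)) 1.
  move=> y; rewrite mulrDr mulr1 (_ : 2 * pi = pi *+ 2) ?sinD2pi//.
  by rewrite mulr_natl.
by move=> /periodic_int-/(_ k x) ->; ring.
Qed.

End arnold.

Section arnold_drift.
Context (R : realType) (tau : R).
Hypothesis htau : 75 / 100 <= tau <= 8 / 10.
Local Notation T := (arnold_map tau (14 / 10)).

(** In terms of t = 2 pi (x - 3 / 4), the map is
T x = 3 / 4 + tau + (t + 1.4 cos t) / (2 pi), and [addM_cos_ge] applies. *)
Lemma arnold_ge x : 75 / 100 <= x -> 171 / 100 <= T x.
Proof.
move=> x34; have pi3 := pi_ge R; have pi0 := @pi_gt0 R.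
rewrite /arnold_map.
pose t := 2 * pi * (x - 75 / 100).
have t0 : 0 <= t by rewrite /t !mulr_ge0//; lra.
have := addM_cos_ge t0.
have -> : sin (2 * pi * x) = - cos t.
  have -> : 2 * pi * x = t - pi / 2 + pi *+ 2.
    by rewrite /t -mulr_natl; field.
  by rewrite sinD2pi sinBpihalf.
move=> H.
have -> : x + tau - 14 / 10 / (2 * pi) * - cos t =
    75 / 100 + tau + (t + 14 / 10 * cos t) / (2 * pi).
  rewrite /t; move: (cos _) pi0; move: (@pi R) => p c p0; field.
  by rewrite gt_eqF.
have : 21 / 100 <= (t + 14 / 10 * cos t) / (2 * pi).
  by rewrite ler_pdivlMr; lra.
by case/andP: htau; lra.
Qed.

Lemma arnold_le x : T x <= x + 103 / 100.
Proof.
have pi3 := pi_ge R; have pi0 := @pi_gt0 R.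
have c0 : 0 <= 14 / 10 / (2 * pi) :> R by rewrite divr_ge0//; lra.
have : 14 / 10 / (2 * pi) <= 23 / 100 :> R.
  by rewrite ler_pdivrMr; lra.
have := sin_geN1 (2 * pi * x).
by rewrite /arnold_map; case/andP: htau => _ ?; nra.
Qed.

End arnold_drift.

(** * Arcs of the circle *)

Section arc.
Context (R : realType).

Definition arc (a b : R) : set R :=
  [set y : R | exists k : int, y - k%:~R \in `[a, b]].

Lemma measurable_arc a b : measurable (arc a b).
Proof.
rewrite (_ : arc a b = \bigcup_n (if unpickle n is Some k then
    `[a + k%:~R, b + k%:~R]%classic else set0)).
  by apply: bigcupT_measurable => n; case: unpickle => // k; exact: measurable_itv.
apply/seteqP; split => [y [k]|y [n _]].
  rewrite in_itv/= lerBrDr lerBlDr => yk; exists (pickle k) => //.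
  by rewrite pickleK/= in_itv.
case: unpickle => // k; rewrite /= in_itv/= => yk; exists k.
by rewrite in_itv/= lerBrDr lerBlDr.
Qed.

Lemma arcDint a b (k : int) y : arc a b (y + k%:~R) <-> arc a b y.
Proof.
split => -[j]; first by exists (j - k); rewrite intrB opprB addrCA addrA [k%:~R + _]addrC.
by exists (j + k); rewrite intrD opprD addrACA subrr addr0.
Qed.

Lemma arcBint a b (m : int) : arc (a - m%:~R) (b - m%:~R) = arc a b.
Proof.
apply/seteqP; split => y -[k]; rewrite in_itv/= => yk.
  by exists (k - m); rewrite in_itv/= intrB; lra.
by exists (k + m); rewrite in_itv/= intrD; lra.
Qed.

Lemma arc_translate a b c y : arc a b (y - c) <-> arc (a + c) (b + c) y.
Proof.
by split => -[k]; rewrite in_itv/= => H; exists k; rewrite in_itv/=; lra.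
Qed.

Lemma sub_arc a b c d : c <= a -> b <= d -> arc a b `<=` arc c d.
Proof.
by move=> ca bd y [k]; rewrite in_itv/= => H; exists k; rewrite in_itv/=; lra.
Qed.

(** After an integer translation the arc starts at c in [0, 1[; being shorter than 1,
it then wraps around at most once and its trace E on [0, 1] consists of at most
two intervals, up to the endpoint 1 identified with 0. *)
Lemma haar_arc a b : 0 <= b - a < 1 -> haar R (arc a b) = (b - a)%:E.
Proof.
move=> ab1; rewrite haarE; last exact: measurable_arc.
pose c := fracpart a; pose l := b - a.
have c01 : 0 <= c < 1 := fracpart_itv a.
have l01 : 0 <= l < 1 := ab1.
have arcE : arc a b = arc c (c + l).
  rewrite -(arcBint a b (Num.floor a)); congr (arc _ _).
  by rewrite /c /l /fracpart; lra.
rewrite arcE.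
pose E := `[c, Num.min 1 (c + l)] `|` `[0, c + l - 1] : set R.
have EarcE : E `<=` arc c (c + l) `&` `[0, 1].
  move=> y [|]; rewrite /= !in_itv/=.
  - rewrite le_min => ?; split; last by lra.
    by exists 0; rewrite in_itv/=; lra.
  - move=> ?; split; last by lra.
    by exists (-1); rewrite in_itv/= intrN; lra.
have arcEE : arc c (c + l) `&` `[0, 1] `<=` E `|` [set 1].
  move=> y [[k]]; rewrite /= !in_itv/= => yk y01.
  have : (-2)%:~R < k%:~R :> R by rewrite intrN; lra.
  have : k%:~R < 2%:~R :> R by lra.
  rewrite !ltr_int => k2 k2'.
  have [kE|[kE|kE]] : k = -1 \/ k = 0 \/ k = 1 by lia.
  - by left; right; rewrite /= in_itv/=; move: yk; rewrite kE intrN; lra.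
  - left; left; rewrite /= in_itv/= le_min; move: yk; rewrite kE => yk.
    by apply/and3P; split; lra.
  - by right => /=; move: yk; rewrite kE; lra.
have mitv (u v : R) : u <= v ->
    lebesgue_measure (`[u, v] : set R) = (v - u)%:E.
  rewrite le_eqVlt => /predU1P[->|uv]; rewrite lebesgue_measure_itv/= lte_fin.
    by rewrite ltxx subrr.
  by rewrite uv -EFinD.
have mE : lebesgue_measure E = l%:E.
  have [cl1|cl1] := leP 1 (c + l).
    pose I := [set` `[c, 1]]; pose J := [set` `[0, c + l - 1]].
    transitivity (lebesgue_measure I + lebesgue_measure J)%E.
      rewrite /E (min_l cl1); apply: measureU; try exact: measurable_itv.
      apply/seteqP; split => // y [] /=; rewrite !in_itv/=; lra.
    rewrite !mitv; [|lra|lra].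
    by rewrite -EFinD; congr EFin; ring.
  rewrite /E (min_r (ltW cl1)) (_ : [set` `[0, c + l - 1]] = set0) ?setU0.
    by rewrite mitv; [congr EFin; ring|lra].
  by apply/seteqP; split => // y /=; rewrite in_itv/=; lra.
have mX : measurable (arc c (c + l) `&` `[0, 1]).
  by apply: measurableI; [exact: measurable_arc|exact: measurable_itv].
have mEset : measurable E by apply: measurableU; exact: measurable_itv.
apply/eqP; rewrite eq_le; apply/andP; split; last first.
  by rewrite -mE; apply: le_measure; rewrite ?inE.
have m1 : measurable (E `|` [set 1]) by exact: measurableU.
apply: (@le_trans _ _ (lebesgue_measure (E `|` [set 1]))).
  by apply: le_measure; rewrite ?inE.
rewrite -mE le_eqVlt; apply/orP; left; apply/eqP; apply: measureU0 => //.
exact: lebesgue_measure_set1.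
Qed.

End arc.

(** * The transition density of a map with uniform noise *)

Lemma Rintegral_indicM d (T : measurableType d) (R : realType)
    (mu : {measure set T -> \bar R}) (A : set T) (f : T -> R) :
  \int[mu]_x (\1_A x * f x) = \int[mu]_(x in A) f x.
Proof.
rewrite [RHS]Rintegral_mkcond; apply: eq_Rintegral => x _.
by rewrite patchE indicE; case: (x \in A); rewrite ?mul1r ?mul0r.
Qed.

Section noise_kernel.
Context (R : realType).
Variables (T : R -> R) (xi : R).
Hypothesis mT : measurable_fun setT T.
Hypothesis xi01 : 0 < xi < 1.

Definition noise_kernel (x y : measurableTypeR R) : R :=
  noise_density xi (y - T x).

Lemma noise_kernelE x y :
  noise_kernel x y = xi^-1 * \1_(arc (T x - xi / 2) (T x + xi / 2)) y.
Proof.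
rewrite /noise_kernel /noise_density; congr (_ * _); rewrite !indicE.
congr (_%:R); congr nat_of_bool; apply/idP/idP; rewrite !inE => H.
  by rewrite addrC [T x + _]addrC; apply/arc_translate.
by apply/(arc_translate (- (xi / 2)) (xi / 2)); rewrite addrC [xi / 2 + _]addrC.
Qed.

Lemma noise_kernel_ge0 x y : 0 <= noise_kernel x y.
Proof.
rewrite noise_kernelE mulr_ge0// invr_ge0.
by have /andP[/ltW] := xi01.
Qed.

Lemma bounded_measurable_noise_kernel : bounded_measurable
  (fun z : measurableTypeR R * measurableTypeR R => noise_kernel z.1 z.2).
Proof.
split; last first.
  exists xi^-1 => z; rewrite ger0_norm ?noise_kernel_ge0// noise_kernelE.
  rewrite ler_piMr ?invr_ge0 ?indic_le1//.
  by have /andP[/ltW] := xi01.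
apply: measurable_funM => //.
apply: (measurableT_comp (measurable_indic (measurable_arc (- (xi / 2)) (xi / 2)))).
apply: measurable_funB => //; exact: (measurableT_comp mT).
Qed.

Lemma Rintegral_noise_kernel (x : R) : \int[haar R]_y noise_kernel x y = 1.
Proof.
under eq_Rintegral do rewrite noise_kernelE.
have mA := measurable_arc (T x - xi / 2) (T x + xi / 2).
rewrite RintegralZl//; last exact: integrable_indic.
transitivity (xi^-1 * fine (haar R (arc (T x - xi / 2) (T x + xi / 2)))).
  by rewrite /Rintegral integral_indic// setIT.
have -> : haar R (arc (T x - xi / 2) (T x + xi / 2)) = xi%:E.
  by rewrite haar_arc; [congr EFin; field|case/andP: xi01; lra].
by rewrite /= mulVf// gt_eqF//; case/andP: xi01.
Qed.

Hypothesis nonsingular : forall A : set R, lebesgue_measure.-negligible A ->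
  lebesgue_measure.-negligible (T @^-1` A).

(** Up to the factor 1 / xi, the convolution at y integrates the density h of the
pushforward over the periodic set A of the points within xi / 2 of y; by the
characteristic property of h this is the integral of f over the preimage of A. *)
Lemma noise_convolution_pushforward f : circle_L1 f ->
  circle_convolution (noise_density xi) (pushforward_op T f) =
  transfer (haar R) noise_kernel f.
Proof.
move=> fL1; have [h hP] := pushforward_density_exists mT nonsingular fL1.
have := xgetI (cst 0) (hP : [set h | pushforward_density T f h] h).
rewrite -/(pushforward_op T f).
move: (pushforward_op _ _) => {hP}h [[ph ih] hP].
case: (fL1) => pf fi.
apply/funext => y; rewrite /circle_convolution /transfer.
pose A := [set z | arc (- (xi / 2)) (xi / 2) (y - z)].
have mA : measurable A.
  rewrite -[A]setTI; apply: (measurable_funB (f := cst y) (g := id)) => //.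
  exact: measurable_arc.
have pA : periodic_set A.
  move=> z; rewrite /A/= -(arcDint _ _ 1).
  by rewrite opprD addrA subrK.
have mTA : measurable (T @^-1` A) by rewrite -[X in measurable X]setTI; exact: mT.
have int_noise (g u : R -> R) : (haar R).-integrable setT (EFin \o g) ->
    measurable (u @^-1` A) ->
    \int[haar R]_x (noise_density xi (y - u x) * g x) =
    xi^-1 * \int[haar R]_(x in u @^-1` A) g x.
  move=> gi muA.
  have b1 : bounded_measurable (\1_(u @^-1` A) : measurableTypeR R -> R).
    exact: bounded_measurable_indic.
  rewrite -[X in _ = _ * X]Rintegral_indicM -RintegralZl//; last first.
    exact: (bounded_measurableMintegrable b1 gi).
  apply: eq_Rintegral => x _; rewrite /noise_density mulrA !indicE.
  by congr (_ * _%:R * _); congr nat_of_bool; apply/idP/idP; rewrite !inE.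
rewrite (int_noise h id)// (int_noise f T)//.
by congr (_ * _); rewrite /Rintegral; congr fine; exact: hP.
Qed.

Lemma circle_L1_transfer f : circle_L1 f ->
  circle_L1 (transfer (haar R) noise_kernel f).
Proof.
move=> [_ fi]; split; last first.
  apply: transfer_integrable fi; exact: bounded_measurable_noise_kernel.
move=> y; apply: eq_Rintegral => x _; congr (_ * _).
rewrite !noise_kernelE !indicE; congr (_ * _%:R); congr nat_of_bool.
by apply/idP/idP; rewrite !inE => /(arcDint _ _ 1).
Qed.

End noise_kernel.

(** * Steering the noisy Arnold map *)

Section arnold_minorization.
Context (R : realType) (tau : R).
Hypothesis htau : 75 / 100 <= tau <= 8 / 10.
Local Notation T := (arnold_map tau (14 / 10)).
Local Notation k := (noise_kernel T (1 / 10)).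
Local Notation Q := (koopman (haar R) k).

Let xi01 : 0 < (1 / 10 : R) < 1. Proof. by lra. Qed.
Let bk := bounded_measurable_noise_kernel (measurable_arnold tau (14 / 10)) xi01.

Let k0 x y : 0 <= k x y. Proof. exact: noise_kernel_ge0. Qed.

Let k1 (x : measurableTypeR R) : \int[haar R]_y k x y = 1.
Proof. exact: Rintegral_noise_kernel. Qed.

Lemma arnold_kernelE (x y a b : R) (m : int) :
  T (x - m%:~R) - 105 / 100 <= a -> b <= T (x - m%:~R) - 95 / 100 ->
  arc a b y -> k x y = 10.
Proof.
move=> Ha Hb aby.
rewrite noise_kernelE indicE mem_set ?mulr1; first by field.
(* T commutes with integer translations, so this is the arc around T (x - m) - 1 *)
rewrite -(arcBint _ _ (m + 1)) intrD.
move: Ha Hb; rewrite -mulrNz arnoldDint mulrNz => Ha Hb.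
by apply: sub_arc aby; lra.
Qed.

Let J : set (measurableTypeR R) := [set` `[75 / 100 : R, 76 / 100]].

Let mJ : measurable J. Proof. exact: measurable_itv. Qed.

(** From a point of the arc [0.75, 0.76] the noise reaches all of J in one step. *)
Lemma koopman_arnold_init phi : bounded_measurable phi ->
  (forall x, 0 <= phi x) ->
  forall x, arc (75 / 100) (76 / 100) x ->
  10 * \int[haar R]_(y in J) phi y <= Q phi x.
Proof.
move=> bphi phi0 x [m]; rewrite in_itv/= => xm.
have b1 : bounded_measurable (\1_J : measurableTypeR R -> R).
  exact: bounded_measurable_indic.
have b1phi := bounded_measurableM b1 bphi.
have Tge : 171 / 100 <= T (x - m%:~R) by apply: arnold_ge => //; lra.
have Tle := arnold_le htau (x - m%:~R).
rewrite -Rintegral_indicM -RintegralZl//; last exact: bounded_measurable_integrable.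
apply: Rintegral_le_koopman => // [|y].
  exact: (bounded_measurableM (bounded_measurable_cst _ 10) b1phi).
rewrite indicE; case: (boolP (y \in J)) => [yJ|_]; last first.
  by rewrite mul0r mulr0 mulr_ge0// noise_kernel_ge0.
have -> : k x y = 10.
  apply: (@arnold_kernelE x y (75 / 100) (76 / 100) m); [lra|lra|].
  by exists 0; rewrite subr0; move: yJ; rewrite inE.
by rewrite mul1r.
Qed.

(** Let x be in the longer arc.  The points reached in one step fill, up to an
integer translation, an interval of length 1/10 that starts at or below
0.75 + l - 0.01 by [arnold_le] and ends at or above 0.76 by [arnold_ge]: it
shares with [0.75, 0.75 + l] an interval B of length 1/100.  As the transition
density is 10, the mean of phi after one step is at least 10 * eta / 100. *)
Lemma koopman_arnold_step phi eta l : bounded_measurable phi ->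
  (forall x, 0 <= phi x) -> 0 <= eta -> 1 / 100 <= l ->
  (forall x, arc (75 / 100) (75 / 100 + l) x -> eta <= phi x) ->
  forall x, arc (75 / 100) (75 / 100 + (l + 1 / 100)) x -> eta / 10 <= Q phi x.
Proof.
move=> bphi phi0 eta0 l1 phieta x [m]; rewrite in_itv/= => xm.
have Tge : 171 / 100 <= T (x - m%:~R) by apply: arnold_ge => //; lra.
have Tle := arnold_le htau (x - m%:~R).
pose c := Num.max (75 / 100) (T (x - m%:~R) - 105 / 100).
have [c1 c2] : 75 / 100 <= c /\ T (x - m%:~R) - 105 / 100 <= c.
  by rewrite !le_max !lexx orbT.
have [c3 c4] : c + 1 / 100 <= 75 / 100 + l /\ c + 1 / 100 <= T (x - m%:~R) - 95 / 100.
  by rewrite /c; case: (leP (75 / 100)) => ?; split; lra.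
pose B : set (measurableTypeR R) := arc c (c + 1 / 100).
have mB : measurable B by exact: measurable_arc.
have b1 : bounded_measurable (\1_B : measurableTypeR R -> R).
  exact: bounded_measurable_indic.
have -> : eta / 10 = \int[haar R]_y (10 * eta * \1_B y).
  rewrite RintegralZl//; last exact: bounded_measurable_integrable.
  transitivity (10 * eta * fine (haar R B)).
    by rewrite haar_arc/=; [field|lra].
  by congr (_ * _); rewrite /Rintegral integral_indic// setIT.
apply: Rintegral_le_koopman => // [|y].
  exact: (bounded_measurableM (bounded_measurable_cst _ (10 * eta)) b1).
rewrite indicE; case: (boolP (y \in B)) => [yB|_]; last first.
  by rewrite mulr0 mulr_ge0// noise_kernel_ge0.
have {}yB := set_mem yB.
rewrite (@arnold_kernelE x y c (c + 1 / 100) m)// mulr1 ler_pM2l//.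
by apply: phieta; apply: sub_arc yB.
Qed.

Lemma iter_koopman_arnold n phi : bounded_measurable phi ->
  (forall x, 0 <= phi x) ->
  forall x, arc (75 / 100) (75 / 100 + n.+1%:R / 100) x ->
  10 * (1 / 10) ^+ n * \int[haar R]_(y in J) phi y <= iter n.+1 Q phi x.
Proof.
move=> bphi phi0.
have J0 : 0 <= \int[haar R]_(y in J) phi y by apply: Rintegral_ge0.
elim: n => [|n IHn] x xn.
  rewrite expr0 mulr1; apply: koopman_arnold_init => //.
  by apply: sub_arc xn; lra.
have -> : 10 * (1 / 10) ^+ n.+1 * \int[haar R]_(y in J) phi y =
    10 * (1 / 10) ^+ n * \int[haar R]_(y in J) phi y / 10.
  by rewrite exprSr; set a := _ ^+ n; field.
apply: (@koopman_arnold_step (iter n.+1 Q phi) _ (n.+1%:R / 100)).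
- exact: bounded_measurable_iter_koopman bk k0 k1 _ _ bphi.
- by move=> y; apply: iter_koopman_ge0 => //; exact: k0.
- by rewrite !mulr_ge0// exprn_ge0//; lra.
- by rewrite ler_pM2r ?ler1n//; lra.
- exact: IHn.
- by apply: sub_arc xn; rewrite ?lexx// -(natr1 n.+1); lra.
Qed.

(** After 100 steps the arc [0.75, 1.75] is the whole circle. *)
Lemma arnold_minorization phi : bounded_measurable phi ->
  (forall x, 0 <= phi x) ->
  forall x, 10 * (1 / 10) ^+ 99 * \int[haar R]_(y in J) phi y <= iter 100 Q phi x.
Proof.
move=> bphi phi0 x; apply: iter_koopman_arnold => //.
exists (Num.floor (x - 75 / 100)); rewrite in_itv/=.
by have := floor_itv (x - 75 / 100); rewrite intrD; lra.
Qed.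

Lemma arnold_transfer_decay g : (haar R).-integrable setT (EFin \o g) ->
  \int[haar R]_x g x = 0 ->
  \int[haar R]_x `|iter n (transfer (haar R) k) g x| @[n --> \oo] --> 0.
Proof.
have J0 : 0 < fine (haar R J).
  have -> : haar R J = (1 / 100)%:E.
    rewrite haarE// setIidl; last by apply: subset_itvScc; rewrite bnd_simp; lra.
    rewrite lebesgue_measure_itv/= lte_fin ifT; last by lra.
    by rewrite -EFinD; congr EFin; lra.
  by rewrite /=; lra.
move=> gi g0; apply: (@doeblin_decay _ _ _ (haar R) k bk k0 k1 100 J
  (10 * (1 / 10) ^+ 99)) => //.
exact: arnold_minorization.
Qed.

End arnold_minorization.

Theorem proposition27 (R : realType) (tau : R)
    (htau : 75 / 100 <= tau <= 8 / 10) (g : R -> R)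
    (hg : circle_BV g) (hg0 : (\int[haar R]_x (g x)%:E = 0)%E) :
  ('N[haar R]_1 [EFin \o iter n (noisy_transfer tau (14 / 10) (1 / 10)) g])%E
    @[n --> \oo] --> 0%E.
Proof.
have xi01 : 0 < (1 / 10 : R) < 1 by lra.
have eps1 : `|14 / 10 : R| != 1 by rewrite ger0_norm; lra.
pose T := arnold_map tau (14 / 10 : R).
have mT : measurable_fun setT T := measurable_arnold tau (14 / 10).
have nsT (A : set R) : lebesgue_measure.-negligible A ->
    lebesgue_measure.-negligible (T @^-1` A).
  exact: negligible_preimage_arnold.
have [gL1 _] := hg.
pose L := transfer (haar R) (noise_kernel T (1 / 10)).
have LE n : circle_L1 (iter n L g) /\
    iter n (noisy_transfer tau (14 / 10) (1 / 10)) g = iter n L g.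
  elim: n => //= n [IHL1 ->]; split; first exact: circle_L1_transfer.
  exact: noise_convolution_pushforward.
have g0 : \int[haar R]_x g x = 0 by rewrite /Rintegral hg0.
rewrite (_ : (fun n => _) =
    EFin \o (fun n => \int[haar R]_x `|iter n L g x|)); last first.
  apply/funext => n; rewrite Lnorm1 (LE n).2 /Rintegral/= fineK//.
  apply: integrable_fin_num => //.
  by have [[_ /integrable_norm]] := LE n.
apply: cvg_EFin; first by near=> n.
exact: arnold_transfer_decay gL1.2 g0.
Unshelve. all: by end_near. Qed.
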